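(* Let $1\le k<n$ and $1\le t\le n-k$ be integers. CORE, built on an $(n,k)$ MSR code for single failure recovery in which a stripe encodes $M$ units of original data, achieves the lower bound of recovery bandwidth for recovering $t$ failed nodes whenever the failure pattern $F$ (the set of the $t$ failed nodes) is good. That is, for a good failure pattern $F$ with $|F|=t$, CORE recovers the lost data of all the failed nodes with recovery bandwidth equal to the lower bound $$ \begin{cases} \dfrac{M\,t\,(n-t)}{k\,(n-k)} & \text{where } t<k,\\[2mm] M & \text{where } t\ge k . \end{cases} $$
   Context: Storage model. All arithmetic is over the Galois field $\mathrm{GF}(2^8)$. There are $n$ nodes $N_0,\dots,N_{n-1}$. Data is encoded stripe by stripe, and $M$ is the amount of original data in a stripe. In a stripe, each node $N_i$ stores $r=n-k$ symbols $s_{i,0},\dots,s_{i,r-1}$. The $nr$ stored symbols are obtained by multiplying a fixed $nr\times kr$ generator matrix by the vector of $kr$ original data symbols, so each symbol has size $\frac{M}{k(n-k)}$. The code is systematic: $k$ of the nodes store the original data symbols. The code is MDS: the symbols stored in any $k$ of the $n$ nodes can be used to reconstruct the original data, and each node stores $\frac{M}{k}$ units of data per stripe. MSR code for single failure recovery. For each pair $i\ne i'$ there is an encoding function $\mathsf{Enc}_{i,i'}$, by which node $N_i$ forms from its $r$ stored symbols one encoded symbol $e_{i,i'}=\mathsf{Enc}_{i,i'}(s_{i,0},\dots,s_{i,r-1})$, of the same size as a stored symbol, for use in reconstructing the failed node $N_{i'}$. For each $i'$ there is a reconstruction function $\mathsf{Rec}_{i'}$ that returns the $r$ stored symbols of $N_{i'}$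 from the $n-1$ encoded symbols $(e_{i,i'})_{i\ne i'}$. Both functions are linear combinations of their inputs. Thus a single failed node is recovered by downloading $\frac{M}{k(n-k)}$ units from each of the $n-1$ surviving nodes, for a total of $\frac{M(n-1)}{k(n-k)}$, which is the minimum recovery bandwidth for a single failure. Recovery bandwidth. When the $t$ nodes of $F$ fail, a relayer downloads data from the surviving nodes (each of which may send linear combinations of its own stored symbols) and reconstructs the lost data of all failed nodes. The recovery bandwidth is the total amount of data downloaded per stripe from the surviving nodes to the relayer. The lower bound of recovery bandwidth for recovering $t$ failed nodes is $\frac{Mt(n-t)}{k(n-k)}$ where $t<k$, and $M$ where $t\ge k$. CORE. For a failed node $N_{i'}$ in $F$, the encoded symbols $e_{i,i'}$ with $N_i\notin F$ are called real symbols, and the encoded symbols $e_{i,i'}$ with $N_i\in F$, $i\ne i'$, are called virtual symbols; there are $t(t-1)$ virtual symbols in total. The relayer downloads the $t$ real symbols $e_{i,i'}$, $N_{i'}\in F$, from each of the $n-t$ surviving nodes $N_i$. The virtual symbols satisfy the $t(t-1)$ equations $$e_{i,i'}=\mathsf{Enc}_{i,i'}\Big(\mathsf{Rec}_{i}\big((e_{j,i})_{j\ne i}\big)\Big),\qquad N_i,N_{i'}\in F,\ i\ne i'.$$ CORE solves this system for the virtual symbols in terms of the real symbols, and then applies $\mathsf{Rec}_{i'}$ to the real and virtual symbols $(e_{i,i'})_{i\ne i'}$ to reconstruct the lost stored symbols of each failed node $N_{i'}$. Good failure pattern. The failure pattern $F$ is good if the virtual symbols can be uniquely expressed, through this system of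 equations, as a function of the real symbols.
   Formalization: For k<t<n-k, downloading all t(n-t) real symbols costs more than M, so here the relayer downloads only a minimal set of real symbols whose linear span contains all real symbols; for t<k, t=k or t=n-k this is every real symbol. *)

(* Defs.v *)
From HB Require Import structures.
From mathcomp Require Import all_boot all_order all_algebra.

Set Implicit Arguments.
Unset Strict Implicit.
Unset Printing Implicit Defensive.

Import GRing.Theory Num.Theory.
Local Open Scope ring_scope.

(* The r = n - k symbols stored by node i are the rows mxvec_index i 0, ...,
   mxvec_index i (r - 1) of the encoded vector.  The reconstruction of node i'
   uses rec_coef i' j only for j <> i', and the encoding for node i' uses
   enc_coef i i' only for i <> i'. *)
Record code (K : fieldType) (n k : nat) := Code {
  gen : 'M[K]_(n * (n - k), k * (n - k));
  enc_coef : 'I_n -> 'I_n -> 'rV[K]_(n - k);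
  rec_coef : 'I_n -> 'I_n -> 'cV[K]_(n - k)
}.

Section Code.
Variables (K : fieldType) (n k : nat) (C : code K n k).
Implicit Types (x y : 'cV[K]_(k * (n - k))).

Definition stored x (i : 'I_n) : 'cV[K]_(n - k) :=
  rowsub (mxvec_index i) (gen C *m x).

Definition Enc (i i' : 'I_n) (s : 'cV[K]_(n - k)) : K :=
  (enc_coef C i i' *m s) 0 0.

Definition Rec (i' : 'I_n) (e : 'I_n -> K) : 'cV[K]_(n - k) :=
  \sum_(j | j != i') e j *: rec_coef C i' j.

Definition systematic : Prop :=
  exists2 A : {set 'I_n}, #|A| = k &
    forall l : 'I_(k * (n - k)), exists2 i : 'I_n, i \in A &
      exists j : 'I_(n - k), forall x, stored x i j 0 = x l 0.

Definition MDS : Prop :=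
  forall A : {set 'I_n}, #|A| = k -> forall x y,
    {in A, forall i, stored x i = stored y i} -> x = y.

Definition encoded x (i i' : 'I_n) : K := Enc i i' (stored x i).

Definition single_repair : Prop :=
  forall x i', Rec i' (fun i => encoded x i i') = stored x i'.

Definition MSR : Prop := [/\ systematic, MDS & single_repair].

(* The linear form on the data computing encoded x p.1 p.2. *)
Definition encoded_form (p : 'I_n * 'I_n) : 'rV[K]_(k * (n - k)) :=
  enc_coef C p.1 p.2 *m rowsub (mxvec_index p.1) (gen C).

End Code.

Section Core.
Variables (K : finFieldType) (n k : nat) (C : code K n k) (F : {set 'I_n}).

(* A table 'M[K]_n holds the symbol e_{i,i'} at entry (i, i').  Only the
   entries with i \notin F, i' \in F of a table of real symbols, and those with
   i, i' \in F, i != i' of a table of virtual symbols, are meaningful. *)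
Definition symbols (re vi : 'M[K]_n) (i i' : 'I_n) : K :=
  if i \in F then vi i i' else re i i'.

Definition virtual_system (re vi : 'M[K]_n) : bool :=
  [forall i in F, forall i' in F, (i != i') ==>
     (vi i i' == Enc C i i' (Rec C i (fun j => symbols re vi j i)))].

Definition good : Prop :=
  forall re : 'M[K]_n, exists2 vi, virtual_system re vi &
    forall vi', virtual_system re vi' ->
      {in F &, forall i i', i != i' -> vi' i i' = vi i i'}.

Definition core_solve (re : 'M[K]_n) : 'M[K]_n :=
  odflt 0 [pick vi | virtual_system re vi].

Definition core_reconstruct (re : 'M[K]_n) (i' : 'I_n) : 'cV[K]_(n - k) :=
  Rec C i' (fun i => symbols re (core_solve re) i i').

Definition real_pairs : {set 'I_n * 'I_n} :=
  [set p | (p.1 \notin F) && (p.2 \in F)].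

Definition real_symbols (x : 'cV[K]_(k * (n - k))) : 'M[K]_n :=
  \matrix_(i, i') (if (i, i') \in real_pairs then encoded C x i i' else 0).

(* When k < t < n - k the t * (n - t) real symbols exceed the k * (n - k) data
   symbols, so they are linearly dependent.  The relayer transfers a real symbol
   only if it is not a linear combination of the others it transfers: the
   transferred set D is minimal among those whose span contains every real
   symbol. *)
Definition form_tuple (D : {set 'I_n * 'I_n}) :
    #|D|.-tuple 'rV[K]_(k * (n - k)) :=
  [tuple encoded_form C (enum_val a) | a < #|D|].

Definition sufficient (D : {set 'I_n * 'I_n}) : bool :=
  (D \subset real_pairs) &&
  [forall p in real_pairs, encoded_form C p \in <<form_tuple D>>%VS].

Definition core_download (D : {set 'I_n * 'I_n}) : bool := minset sufficient D.

Definition downloaded (D : {set 'I_n * 'I_n}) (x : 'cV[K]_(k * (n - k))) :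
    'rV[K]_#|D| :=
  \row_a encoded C x (enum_val a).1 (enum_val a).2.

(* All real symbols, computed from the transferred ones alone. *)
Definition complete_real (D : {set 'I_n * 'I_n}) (y : 'rV[K]_#|D|) : 'M[K]_n :=
  \matrix_(i, i')
    (if (i, i') \in real_pairs
     then \sum_a coord (form_tuple D) a (encoded_form C (i, i')) * y 0 a
     else 0).

Definition core_relayer (D : {set 'I_n * 'I_n}) (y : 'rV[K]_#|D|) :
    'I_n -> 'cV[K]_(n - k) :=
  core_reconstruct (complete_real y).

End Core.

Definition symbol_size (R : realFieldType) (M : R) (n k : nat) : R :=
  M / (k%:R * (n - k)%:R).

Definition bandwidth (R : realFieldType) (M : R) (n k : nat)
    (D : {set 'I_n * 'I_n}) : R :=
  #|D|%:R * symbol_size M n k.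

Definition lower_bound (R : realFieldType) (M : R) (n k t : nat) : R :=
  if (t < k)%N then (M * t%:R * (n - t)%:R) / (k%:R * (n - k)%:R) else M.

(* Main.v *)
(** The true virtual symbols solve the system, so for a good pattern CORE finds
    them, and the real symbols determine the data of [F].  If [t >= k], the MDS
    property shows that the real symbols determine the whole stripe, so a minimal
    transferred set is a basis of the dual of the data space, of size [k (n - k)].
    If [t < k], choose any [k - t] survivors [S]: by the MDS property the stripe
    is determined by the [(k - t) (n - k)] symbols stored on [S] together with
    the [t (n - k)] real symbols of the other [n - k] survivors.  These are
    exactly [k (n - k)] linear forms, so none of the latter is redundant; since
    every survivor can be left out of [S], no real symbol is redundant. *)
Require Import Defs.
From mathcomp Require Import all_boot all_order all_algebra.

Set Implicit Arguments.
Unset Strict Implicit.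
Unset Printing Implicit Defensive.

Import GRing.Theory Num.Theory.
Local Open Scope ring_scope.

(** Stacked as the rows of a matrix, separating forms define an injective linear map; its rank [N]
    is at most its number of rows. *)
Lemma separating_forms_size (K : fieldType) (N : nat) (X : seq 'rV[K]_N) :
  (forall x y : 'cV[K]_N, {in X, forall v, v *m x = v *m y} -> x = y) ->
  (N <= size X)%N.
Proof.
move=> X_sep; pose B := \matrix_(a < size X) X`_a.
suff /eqP BT_free : row_free B^T by rewrite -[leqLHS]BT_free rank_leq_col.
apply/inj_row_free => u uB0; apply: trmx_inj; rewrite trmx0; apply: X_sep.
move=> v /(nthP 0) [a lt_a <-]; rewrite mulmx0.
rewrite -[X`_a](rowK (fun b => X`_b) (Ordinal lt_a)) -/B -row_mul.
by rewrite -[B]trmxK -trmx_mul uB0 trmx0 row0.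
Qed.

Lemma exists_set_size_between (T : finType) (A B : {set T}) (m : nat) :
  A \subset B -> (#|A| <= m <= #|B|)%N ->
  exists E : {set T}, [/\ A \subset E, E \subset B & #|E| = m].
Proof.
move=> sAB /andP [leAm lemB].
have: (m - #|A| <= #|B :\: A|)%N by rewrite cardsD (setIidPr sAB) leq_sub2r.
case/card_geqP => s [Us sz_s ss].
have sDs: [set:: s] \subset B :\: A by apply/subsetP=> z; rewrite inE; apply: ss.
exists (A :|: [set:: s]); split; first exact: subsetUl.
  by rewrite subUset sAB (subset_trans sDs) ?subsetDl.
rewrite cardsU disjoint_setI0; last first.
  by rewrite disjoint_sym; move: sDs; rewrite subsetD => /andP [].
by rewrite cards0 subn0 cardsE (card_uniqP Us) sz_s subnKC.
Qed.

Section Forms.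
Variables (K : fieldType) (n k : nat) (C : code K n k).
Implicit Type x : 'cV[K]_(k * (n - k)).

Definition stored_form (i : 'I_n) (j : 'I_(n - k)) : 'rV[K]_(k * (n - k)) :=
  row j (rowsub (mxvec_index i) (gen C)).

Lemma stored_formE x i j : stored_form i j *m x = row j (stored C x i).
Proof. by rewrite /stored_form -row_mul mul_rowsub_mx. Qed.

Lemma encoded_formE x p : (encoded_form C p *m x) 0 0 = encoded C x p.1 p.2.
Proof. by rewrite /encoded_form -mulmxA mul_rowsub_mx. Qed.

Lemma eq_Rec i (e e' : 'I_n -> K) :
  (forall j, j != i -> e j = e' j) -> Rec C i e = Rec C i e'.
Proof. by move=> ee'; apply: eq_bigr => j /ee' ->. Qed.

End Forms.

Section Core.
Variables (K : finFieldType) (n k : nat) (C : code K n k) (F : {set 'I_n}).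
Implicit Types (x y : 'cV[K]_(k * (n - k))) (D : {set 'I_n * 'I_n}).

Lemma mem_form_tuple D p : p \in D -> encoded_form C p \in form_tuple C D.
Proof.
move=> pD; apply/tnthP; exists (enum_rank_in pD p).
by rewrite tnth_mktuple enum_rankK_in.
Qed.

Lemma form_tuple_nth D (a : 'I_#|D|) :
  (form_tuple C D)`_a = encoded_form C (enum_val a).
Proof. by rewrite -tnth_nth tnth_mktuple. Qed.

Lemma span_form_tuple_le D (U : {vspace 'rV[K]_(k * (n - k))}) :
  {in D, forall p, encoded_form C p \in U} -> (<<form_tuple C D>> <= U)%VS.
Proof.
move=> DU; apply/span_subvP => v /tnthP [a ->].
by rewrite tnth_mktuple DU ?enum_valP.
Qed.

Lemma sufficientP D :
  reflect (D \subset real_pairs F /\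
           {in real_pairs F, forall p, encoded_form C p \in <<form_tuple C D>>%VS})
          (sufficient C F D).
Proof.
apply: (iffP andP) => -[sDr H]; split=> //; first by move=> p; apply: (forall_inP H).
exact/forall_inP.
Qed.

Lemma sufficient_real_pairs : sufficient C F (real_pairs F).
Proof. by apply/sufficientP; split=> // p pr; rewrite memv_span ?mem_form_tuple. Qed.

(** A linear relation between forms also holds between their values at [x], so the coordinates of a
    real form over the transferred forms compute its real symbol. *)
Lemma complete_real_downloaded D x :
  sufficient C F D -> complete_real C F (downloaded C D x) = real_symbols C F x.
Proof.
case/sufficientP => _ D_span; apply/matrixP=> i i'; rewrite !mxE.
case: ifP => // pr; rewrite -(encoded_formE C x (i, i')).
rewrite [in RHS](coord_span (D_span _ pr)) mulmx_suml summxE.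
apply: eq_bigr => a _.
by rewrite -scalemxAl [RHS]mxE form_tuple_nth encoded_formE mxE.
Qed.

(** In a nontrivial relation, a form with nonzero coefficient lies in the span of the others, so its
    pair could be dropped from [D], against minimality. *)
Lemma core_download_free D : core_download C F D -> free (form_tuple C D).
Proof.
case/minsetP=> /sufficientP [sDr D_span] D_min; apply/freeP => c c0 a.
apply/eqP/negPn/negP => ca_neq0; pose p := enum_val a.
have pD : p \in D by apply: enum_valP.
suff Dp_suff: sufficient C F (D :\ p).
  by have := D_min _ Dp_suff (subsetDl _ _) => /setP /(_ p); rewrite !inE eqxx pD.
have p_span: encoded_form C p \in <<form_tuple C (D :\ p)>>%VS.
  move: c0; rewrite (bigD1 a) //= form_tuple_nth => /eqP; rewrite addr_eq0 => /eqP cE.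
  rewrite -[encoded_form C p](scalerK ca_neq0) cE memvZ // memvN memv_suml //.
  move=> b ba; rewrite form_tuple_nth memvZ // memv_span // mem_form_tuple // !inE enum_valP andbT.
  by rewrite (inj_eq enum_val_inj).
apply/sufficientP; split; first exact: subset_trans (subsetDl _ _) sDr.
move=> q /D_span; apply/subvP/span_form_tuple_le => q' q'D.
have [-> //|q'p] := eqVneq q' p.
by rewrite memv_span // mem_form_tuple // !inE q'p.
Qed.

Lemma core_download_exists : exists D, core_download C F D.
Proof.
by have [D D_min _] := minset_exists sufficient_real_pairs; exists D.
Qed.

Lemma card_real_pairs : #|real_pairs F| = (#|F| * (n - #|F|))%N.
Proof.
have ->: real_pairs F = setX (~: F) F by apply/setP => p; rewrite !inE.
by rewrite cardsX cardsCs setCK card_ord mulnC.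
Qed.

Hypotheses (C_MSR : MSR C) (F_good : good C F).

Lemma core_reconstruct_real x :
  {in F, forall i', core_reconstruct C F (real_symbols C F x) i' = stored C x i'}.
Proof.
have [_ _ C_rep] := C_MSR; set re := real_symbols C F x.
pose vi : 'M[K]_n := \matrix_(i, i') encoded C x i i'.
(* This serves twice: for the table of true symbols, to show that it solves the system, and for the
   table that CORE picks. *)
have Rec_true (vi' : 'M[K]_n) i' : i' \in F ->
    (forall i, i \in F -> i != i' -> vi' i i' = encoded C x i i') ->
    Rec C i' (fun i => symbols F re vi' i i') = stored C x i'.
  move=> i'F vi'E; rewrite -[RHS]C_rep; apply: eq_Rec => i i_i'; rewrite /symbols.
  by case: (boolP (i \in F)) => iF; rewrite ?vi'E // mxE inE /= iF i'F.
have vi_sys: virtual_system C F re vi.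
  apply/forall_inP => i iF; apply/forall_inP => i' i'F; apply/implyP => _.
  by rewrite Rec_true ?mxE // => j _ _; rewrite mxE.
move=> i' i'F; apply: Rec_true => // i iF i_i'.
(* The default table of [core_solve] never arises, since [vi] is a solution. Goodness then makes the
   picked solution agree with [vi] off the diagonal. *)
rewrite /core_solve; case: pickP => [vi' vi'_sys | /(_ vi)]; last by rewrite vi_sys.
have [vi0 _ vi0_uniq] := F_good re.
by rewrite (vi0_uniq _ vi'_sys) // -(vi0_uniq _ vi_sys) // mxE.
Qed.

Lemma core_relayer_downloaded D x : sufficient C F D ->
  {in F, forall i', core_relayer C F (downloaded C D x) i' = stored C x i'}.
Proof.
move=> D_suff i' i'F.
by rewrite /core_relayer complete_real_downloaded // core_reconstruct_real.
Qed.

(** The relayer sees only the transferred symbols, so stripes agreeing on them get the same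
    reconstruction. This prepares the use of the MDS property. *)
Lemma eq_encoded_stored D x y : sufficient C F D ->
    {in D, forall p, encoded C x p.1 p.2 = encoded C y p.1 p.2} ->
  {in F, forall i, stored C x i = stored C y i}.
Proof.
move=> D_suff xy i' i'F; have eq_xy : downloaded C D x = downloaded C D y.
  by apply/rowP => a; rewrite !mxE xy ?enum_valP.
by rewrite -(core_relayer_downloaded x D_suff i'F) eq_xy core_relayer_downloaded.
Qed.

Lemma card_core_download D :
  (k <= #|F|)%N -> core_download C F D -> #|D| = (k * (n - k))%N.
Proof.
move=> le_kF D_core; have D_suff := minsetp D_core.
have [_ C_MDS _] := C_MSR; apply/eqP; rewrite eqn_leq; apply/andP; split.
  (* Upper bound: independent forms are at most as many as the dimension of the dual of the data
     space. *)
  have := core_download_free D_core; rewrite /free size_tuple => /eqP <-.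
  by rewrite (leq_trans (dimvS (subvf _))) // dimvf /dim /= mul1n.
(* Lower bound: the transferred forms separate stripes, since they determine the contents of [k]
   failed nodes. *)
have [|A [_ sAF cardA]] := @exists_set_size_between _ set0 F k (sub0set F).
  by rewrite cards0.
rewrite -(size_tuple (form_tuple C D)).
apply: separating_forms_size => x y xy; apply: (C_MDS A) => // i /(subsetP sAF).
by apply: (eq_encoded_stored D_suff) => p pD; rewrite -!encoded_formE xy // mem_form_tuple.
Qed.

Lemma core_download_real_pairs D :
  (#|F| < k)%N -> (k < n)%N -> core_download C F D -> D = real_pairs F.
Proof.
move=> lt_Fk lt_kn D_core; have D_suff := minsetp D_core.
have [_ C_MDS _] := C_MSR; have [sDr _] := sufficientP _ D_suff.
apply/eqP; rewrite eqEsubset sDr; apply/subsetP => p pr; apply/negPn/negP => pD.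
move: (pr); rewrite inE => /andP [p1F p2F].
(* [A] joins to [F] some [k - t] survivors other than [p.1], which exist because [k <= n - 1]. *)
have [A [sFA sAp cardA]] : exists A : {set 'I_n},
    [/\ F \subset A, A \subset [set~ p.1] & #|A| = k].
  apply: exists_set_size_between; first by rewrite subsetC sub1set inE.
  by rewrite cardsC1 card_ord (ltnW lt_Fk) -ltnS (ltn_predK lt_kn).
pose S := A :\: F; pose T := setX (~: A) F.
have pT : p \in T.
  by rewrite !inE p2F andbT; apply/negP => /(subsetP sAp); rewrite !inE eqxx.
(* If [p] could be left out, these forms would still separate stripes, although they are one fewer
   than the dimension. *)
pose X := [seq stored_form C i j | i <- enum S, j <- enum 'I_(n - k)]
          ++ [seq encoded_form C q | q <- enum (T :\ p)].
have szX : (size X).+1 = (k * (n - k))%N.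
  have cT := cardsD1 p T; rewrite pT cardsX cardsCs setCK card_ord cardA in cT.
  rewrite size_cat size_allpairs size_map size_enum_ord -!cardE -addnS -add1n -cT.
  by rewrite cardsD (setIidPr sFA) cardA mulnC [RHS]mulnC -mulnDr subnK // ltnW.
suff: (k * (n - k) <= size X)%N by rewrite -[leqLHS]szX ltnn.
apply: separating_forms_size => x y xy.
have xyS : {in S, forall i, stored C x i = stored C y i}.
  move=> i iS; apply/row_matrixP => j; rewrite -!stored_formE xy // mem_cat.
  by rewrite allpairs_f ?mem_enum.
apply: (C_MDS A cardA) => i iA; have [iF|iF] := boolP (i \in F); last first.
  by apply: xyS; rewrite inE iF.
apply: (eq_encoded_stored D_suff) iF => q qD.
(* A transferred symbol is either computed from the contents of a node of [S] or comes from a pair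
   of [T], distinct from [p] because [p] is not in [D]. *)
have [q1S|q1S] := boolP (q.1 \in S); first by rewrite /encoded xyS.
rewrite -!encoded_formE xy // mem_cat; apply/orP; right; apply: map_f.
have /(subsetP sDr) := qD; move: q1S; rewrite mem_enum !inE.
have -> /= : q != p by apply: contraNneq pD => <-.
by case: (q.1 \in F) => //= -> ->.
Qed.

End Core.

Theorem theorem2 (K : finFieldType) (R : realFieldType) (n k t : nat) (M : R)
    (C : code K n k) (F : {set 'I_n})
    (card_K : #|K| = (2 ^ 8)%N)
    (k_ge1 : (1 <= k)%N) (lt_kn : (k < n)%N)
    (t_ge1 : (1 <= t)%N) (le_t : (t <= n - k)%N)
    (C_MSR : MSR C) (card_F : #|F| = t) (F_good : good C F) :
  [/\ forall x, {in F, forall i',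
        core_reconstruct C F (real_symbols C F x) i' = stored C x i'},
      exists D, core_download C F D,
      (t < k)%N -> forall D, core_download C F D -> D = real_pairs F
    & forall D, core_download C F D ->
        (forall x, {in F, forall i',
           core_relayer C F (downloaded C D x) i' = stored C x i'}) /\
        bandwidth M k D = lower_bound M n k t].
Proof.
have real_only : (t < k)%N -> forall D, core_download C F D -> D = real_pairs F.
  by move=> lt_tk D; apply: core_download_real_pairs; rewrite ?card_F.
split=> //; first exact: core_reconstruct_real.
  exact: core_download_exists.
move=> D D_core; have D_suff := minsetp D_core.
split=> [x|]; first exact: core_relayer_downloaded.
rewrite /bandwidth /lower_bound /symbol_size; case: ltnP => [lt_tk | le_kt].
  by rewrite (real_only lt_tk _ D_core) card_real_pairs card_F natrM mulrCA !mulrA.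
(* Here the [k * (n - k)] transferred symbols cancel the denominator of the symbol size, nonzero
   because [1 <= k < n]. *)
rewrite (card_core_download C_MSR F_good _ D_core) ?card_F // -natrM mulrC.
by rewrite divfK // pnatr_eq0 muln_eq0 negb_or -!lt0n k_ge1 subn_gt0.
Qed.
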